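(* Let $\beta\in[0,1)$ and $f\in\mathcal{S}_{cs}(\beta)$. Then for $|z|=r$, $0<r<1$, $$-\tilde f(-r)\le|f(z)|\le\tilde f(r),\qquad\text{where}\quad \tilde f(z)=z\left(\frac{1+\beta z}{1-z}\right)^{\frac1{1+\beta}}.$$
   Context: $\Delta=\{z\in\mathbb{C}:|z|<1\}$. $\mathcal{A}$ is the class of analytic functions $f(z)=z+\sum_{k\ge2}a_kz^k$ in $\Delta$. For analytic $g,h$ on $\Delta$, $g\prec h$ (subordination) means $g=h\circ\omega$ for some analytic $\omega:\Delta\to\Delta$ with $\omega(0)=0$. $\mathcal{S}_{cs}(\beta)$ is the class of $f\in\mathcal{A}$ with $\frac{zf'(z)}{f(z)}-1\prec\frac{z}{(1-z)(1+\beta z)}$ in $\Delta$ (in particular $zf'(z)/f(z)$ is analytic in $\Delta$). Powers are principal branches. *)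

(* Defs.v *)
From Stdlib Require Import Reals.
From Coquelicot Require Import Coquelicot.

Open Scope C_scope.

Definition Delta (z : C) : Prop := (Cmod z < 1)%R.

(* Functions on an open set D are total functions C -> C whose values outside D
   are irrelevant. Analytic: locally the sum of a convergent power series. *)
Definition analytic_on (D : C -> Prop) (f : C -> C) : Prop :=
  forall z0 : C, D z0 ->
    exists (rho : R) (a : nat -> C), (0 < rho)%R /\
      forall z : C, (Cmod (z - z0) < rho)%R ->
        is_pseries (K := C_AbsRing) (V := C_NormedModule) a (z - z0) (f z).

Definition class_A (f : C -> C) : Prop :=
  analytic_on Delta f /\
  exists a : nat -> C, a 0%nat = 0 /\ a 1%nat = 1 /\
    forall z : C, Delta z ->
      is_pseries (K := C_AbsRing) (V := C_NormedModule) a z (f z).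

Definition subordinate (g h : C -> C) : Prop :=
  analytic_on Delta g /\ analytic_on Delta h /\
  exists w : C -> C,
    analytic_on Delta w /\ (forall z : C, Delta z -> Delta (w z)) /\ w 0 = 0 /\
    forall z : C, Delta z -> g z = h (w z).

Definition h_cs (beta : R) (z : C) : C := z / ((1 - z) * (1 + beta * z)).

(* q is the meromorphic function z f'(z) / f(z), assumed analytic on Delta: it is
   given by the quotient off the (isolated) zeros of f, at which the singularity
   is removed by the analyticity of q; in particular q(0) = 1. *)
Definition S_cs (beta : R) (f : C -> C) : Prop :=
  class_A f /\
  exists q : C -> C,
    analytic_on Delta q /\
    (forall z : C, Delta z -> f z <> 0 -> q z = z * C_derive f z / f z) /\
    subordinate (fun z : C => q z - 1) (h_cs beta).

(* Principal argument, in (-PI, PI], for z <> 0. *)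
Definition Carg (z : C) : R :=
  if Rle_dec 0 (Im z) then acos (Re z / Cmod z) else (- acos (Re z / Cmod z))%R.

Definition Clog (z : C) : C := (ln (Cmod z), Carg z).

Definition Cexp (z : C) : C :=
  ((exp (Re z) * cos (Im z))%R, (exp (Re z) * sin (Im z))%R).

(* Principal branch of z^a, for z <> 0. *)
Definition Cpower (z a : C) : C := Cexp (a * Clog z).

Definition f_tilde (beta : R) (z : C) : C :=
  z * Cpower ((1 + beta * z) / (1 - z)) (1 / (1 + beta)).

(* An inequality between complex expressions that are meant to be real: for a
   real x or y, it also asserts that the other side is real. *)
Definition Cle (x y : C) : Prop := Im x = Im y /\ (Re x <= Re y)%R.

(* Main.v *)
From Stdlib Require Import Reals Lra Psatz Classical ClassicalEpsilon.
From Coquelicot Require Import Coquelicot.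
Require Import Defs.

(** Write [q z = z f'(z) / f(z)], so that [q - 1 = h o w] for the function
    [h z = z / ((1 - z) (1 + beta z))] and a Schwarz function [w].  Along a ray
    [t |-> f (t e)] with [|e| = 1], the logarithmic derivative of [|f|] is
    [Re q / t], so two-sided bounds on [Re q] over the circle [|z| = t]
    integrate to two-sided bounds on [|f|].

    The Schwarz lemma gives [|w z| <= |z|].  The partial fraction decomposition
    [(1 + beta) h z = 1 / (1 - z) - 1 / (1 + beta z)] then shows that [Re h] over
    the disc of radius [t] lies between [h (- t)] and [h t]: both bounds hold
    term by term, because [Re (1 / (1 - v))] lies between [1 / (1 + s)] and
    [1 / (1 - s)] when [|v| <= s < 1] ([Re_inv_bounds], [Re_h_cs_bounds]).
    Finally [h t / t] is the derivative of
    [(ln (1 + beta t) - ln (1 - t)) / (1 + beta)], which is the logarithm of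
    [f_tilde t / t]; likewise [h (- t) / t] belongs to [f_tilde (- t)].

    The logarithm of [|f|] is avoided, and with it the question whether [f]
    vanishes: the identity [(|f|^2)' = 2 |f|^2 Re q / t] is true also at a zero
    of [f], where both sides are [0].  Hence [|f|^2 / t^2] times
    [exp (- 2 ln (f_tilde t / t))] is monotone in [t], and its limit at [0] is
    [1] because [f z = z + O(z^2)] ([growth_comparison]).

    The Schwarz lemma is obtained from power series alone.  The function [w z / z] has
    second order Taylor expansions at all points of the unit disc.  For such a
    function [g], the mean of [|g|^2 + eps |z|^2] over the four vertices of a
    small square centred at [p] exceeds the value at [p], so this function has no interior
    maximum; letting [eps] tend to [0] yields the maximum principle. *)

Open Scope R_scope.

(** * Power series expansions and Taylor jets *)

Lemma pow_n_C (z : C) (n : nat) : @pow_n C_AbsRing z n = (z ^ n)%C.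
Proof. induction n as [|n IH]; [reflexivity|]. simpl. rewrite IH. reflexivity. Qed.

(** Analyticity at [z0], with the centre moved to the origin, so that the
    coefficient shift below stays within the same notion. *)
Definition has_expansion (f : C -> C) (z0 : C) (rho : R) (a : nat -> C) : Prop :=
  forall w : C, Cmod w < rho ->
    is_pseries (K := C_AbsRing) (V := C_NormedModule) a w (f (z0 + w)%C).

Lemma expansion_center (f : C -> C) z0 rho a :
  0 < rho -> has_expansion f z0 rho a -> f z0 = a 0%nat.
Proof.
  intros Hrho H.
  specialize (H 0%C). rewrite Cmod_0, Cplus_0_r in H. specialize (H Hrho).
  exact (filterlim_locally_unique _ _ _ H (is_pseries_0 a)).
Qed.

(** Removing the constant term of a power series and dividing by [w] leaves a
    power series with the same disc.  Iterating this produces Taylor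
    expansions with a remainder that is itself analytic, hence bounded. *)
Lemma expansion_peel (f : C -> C) z0 rho a :
  0 < rho -> has_expansion f z0 rho a ->
  exists g : C -> C, has_expansion g 0 rho (fun n => a (S n)) /\
    forall w : C, Cmod w < rho -> f (z0 + w)%C = (a 0%nat + w * g w)%C.
Proof.
  intros Hrho H.
  exists (fun w : C => if excluded_middle_informative (w = RtoC 0) then a 1%nat
                   else (/ w * (f (z0 + w) - a 0%nat))%C).
  split.
  - intros w Hw. rewrite Cplus_0_l.
    destruct (excluded_middle_informative (w = RtoC 0)) as [->|Hw0].
    + exact (is_pseries_0 (K := C_AbsRing) (V := C_NormedModule) (fun n => a (S n))).
    + refine (is_pseries_decr_1 (K := C_AbsRing) (V := C_NormedModule)
                a w (/ w)%C _ _ (H w Hw)).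
      exact (Cinv_l w Hw0).
  - intros w Hw. destruct (excluded_middle_informative (w = RtoC 0)) as [->|Hw0].
    + rewrite Cplus_0_r, (expansion_center f z0 rho a Hrho H). ring.
    + field. exact Hw0.
Qed.

(** Convergence at the single point [rho / 2] bounds [|a n| (rho / 2)^n]; for
    [|w| <= rho / 4] the series is then dominated by a geometric series of
    ratio [1 / 2]. *)
Lemma expansion_bounded (g : C -> C) rho a :
  0 < rho -> has_expansion g 0 rho a ->
  exists K, forall w : C, Cmod w <= rho / 4 -> Cmod (g w) <= K.
Proof.
  intros Hrho H.
  assert (H1 : Cmod (rho / 2)%R < rho).
  { rewrite Cmod_R, Rabs_pos_eq by lra. lra. }
  pose proof (H (RtoC (rho / 2)%R) H1) as HS.
  destruct (filterlim_bounded _ (ex_intro _ _ HS)) as [M HM].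
  assert (HM' : forall n, Cmod (sum_n (fun k => (RtoC (rho / 2) ^ k * a k)%C : C_NormedModule) n) <= M).
  { intros n. erewrite sum_n_ext; [exact (HM n)|].
    intros k. rewrite <- pow_n_C. reflexivity. }
  assert (Ha : forall n, (rho / 2) ^ n * Cmod (a n) <= 2 * M).
  { intros n.
    assert (E : (rho / 2) ^ n * Cmod (a n) = Cmod (RtoC (rho / 2) ^ n * a n)).
    { rewrite Cmod_mult, Cmod_pow, Cmod_R, Rabs_pos_eq by lra. reflexivity. }
    rewrite E. destruct n as [|n].
    - specialize (HM' 0%nat). rewrite sum_O in HM'. 
      pose proof (Cmod_ge_0 (RtoC (rho / 2) ^ 0 * a 0%nat)). lra.
    - pose proof (HM' n) as A. pose proof (HM' (S n)) as B. rewrite sum_Sn in B.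
      set (s := sum_n _ n) in *.
      change (plus s (RtoC (rho / 2) ^ S n * a (S n))%C) with
        (s + RtoC (rho / 2) ^ S n * a (S n))%C in B.
      set (t := (RtoC (rho / 2) ^ S n * a (S n))%C) in *.
      replace t with ((s + t) + - s)%C by ring.
      eapply Rle_trans; [apply Cmod_triangle|]. rewrite Cmod_opp. lra. }
  assert (HM0 : 0 <= M).
  { eapply Rle_trans; [apply Cmod_ge_0|apply (HM' 0%nat)]. }
  exists (4 * M). intros w Hw.
  assert (Hw1 : Cmod w < rho) by lra.
  pose proof (H w Hw1) as HW. rewrite Cplus_0_l in HW.
  assert (Hpart : forall n, Cmod (sum_n (fun k => scal (pow_n (K := C_AbsRing) w k) (a k) : C_NormedModule) n)
                     <= 4 * M - 2 * M * (1 / 2) ^ n).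
  { assert (Ht : forall n, Cmod (w ^ n * a n)%C <= 2 * M * (1 / 2) ^ n).
    { intros n. rewrite Cmod_mult, Cmod_pow.
      assert (Cmod w ^ n <= (rho / 2) ^ n * (1 / 2) ^ n).
      { rewrite <- Rpow_mult_distr. apply pow_incr. split; [apply Cmod_ge_0|lra]. }
      pose proof (Cmod_ge_0 (a n)). specialize (Ha n).
      assert (0 < (1 / 2) ^ n) by (apply pow_lt; lra).
      apply Rle_trans with (((rho / 2) ^ n * (1 / 2) ^ n) * Cmod (a n)).
      - apply Rmult_le_compat_r; assumption.
      - replace ((rho / 2) ^ n * (1 / 2) ^ n * Cmod (a n))
          with (((rho / 2) ^ n * Cmod (a n)) * (1 / 2) ^ n) by ring.
        apply Rmult_le_compat_r; lra. }
    induction n as [|n IH].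
    - rewrite sum_O, pow_n_C. specialize (Ht 0%nat). simpl in *. 
      change (Cmod (1 * a 0%nat) <= 4 * M - 2 * M * 1). lra.
    - rewrite sum_Sn, pow_n_C.
      eapply Rle_trans; [apply Cmod_triangle|]. 
      specialize (Ht (S n)).
      change (Cmod (scal (w ^ S n)%C (a (S n)))) with (Cmod (w ^ S n * a (S n))).
      change ((1 / 2) ^ S n) with (1 / 2 * (1 / 2) ^ n) in *. lra. }
  assert (Hl := filterlim_comp _ _ _ _ _ _ _ _ HW (filterlim_norm (g w : C_NormedModule))).
  refine (closed_filterlim _ (fun u : R => u <= 4 * M) _ Hl _ (closed_le _)).
  intros n. specialize (Hpart n).
  assert (0 < (1 / 2) ^ n) by (apply pow_lt; lra).
  eapply Rle_trans; [exact Hpart|]. nra.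
Qed.

Lemma expansion_of_analytic D f z0 :
  analytic_on D f -> D z0 -> exists rho a, 0 < rho /\ has_expansion f z0 rho a.
Proof.
  intros H Hz. destruct (H z0 Hz) as (rho & a & Hrho & Ha).
  exists rho, a. split; [exact Hrho|]. intros w Hw.
  replace w with (z0 + w - z0)%C at 1 by ring. apply Ha.
  replace (z0 + w - z0)%C with w by ring. exact Hw.
Qed.

(** Taylor expansions of order one and two with a bounded remainder
    coefficient [e].  These are the only consequences of analyticity that the
    derivative of [f] and the maximum principle need. *)
Definition jet1 (g : C -> C) (z0 c1 : C) : Prop :=
  exists K d, 0 < d /\ forall w, Cmod w < d -> exists e, Cmod e <= K /\
    g (z0 + w)%C = (g z0 + w * (c1 + w * e))%C.

Definition jet2 (g : C -> C) (z0 : C) : Prop :=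
  exists c1 c2 K d, 0 < d /\ forall w, Cmod w < d -> exists e, Cmod e <= K /\
    g (z0 + w)%C = (g z0 + w * (c1 + w * (c2 + w * e)))%C.

Lemma expansion_jet1 f z0 rho a :
  0 < rho -> has_expansion f z0 rho a -> jet1 f z0 (a 1%nat).
Proof.
  intros Hrho H.
  destruct (expansion_peel _ _ _ _ Hrho H) as (g & Hg & Eg).
  destruct (expansion_peel _ _ _ _ Hrho Hg) as (g2 & Hg2 & Eg2).
  destruct (expansion_bounded _ _ _ Hrho Hg2) as [K HK].
  exists K, (rho / 4). split; [lra|]. intros w Hw.
  exists (g2 w). split; [apply HK; lra|].
  rewrite Eg, (expansion_center _ _ _ _ Hrho H) by lra.
  rewrite <- (Cplus_0_l w) at 2. rewrite Eg2 by lra. reflexivity.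
Qed.

Lemma expansion_jet2 f z0 rho a :
  0 < rho -> has_expansion f z0 rho a -> jet2 f z0.
Proof.
  intros Hrho H.
  destruct (expansion_peel _ _ _ _ Hrho H) as (g & Hg & Eg).
  destruct (expansion_peel _ _ _ _ Hrho Hg) as (g2 & Hg2 & Eg2).
  destruct (expansion_peel _ _ _ _ Hrho Hg2) as (g3 & Hg3 & Eg3).
  destruct (expansion_bounded _ _ _ Hrho Hg3) as [K HK].
  exists (a 1%nat), (a 2%nat), K, (rho / 4). split; [lra|]. intros w Hw.
  exists (g3 w). split; [apply HK; lra|].
  rewrite Eg, (expansion_center _ _ _ _ Hrho H) by lra.
  rewrite <- (Cplus_0_l w) at 2. rewrite Eg2 by lra. 
  rewrite <- (Cplus_0_l w) at 3. rewrite Eg3 by lra. reflexivity.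
Qed.

Lemma jet1_C_derive f z0 c1 : jet1 f z0 c1 -> C_derive f z0 = c1.
Proof.
  intros (K & d & Hd & H). apply is_C_derive_unique. split.
  - apply is_linear_scal_l.
  - intros x Hx. 
    pose proof (is_filter_lim_locally_unique (V := AbsRing_NormedModule C_AbsRing) z0 x Hx).
    subst x.
    intros eps.
    assert (HK : 0 < Rmax K 1) by (apply Rlt_le_trans with 1; [lra|apply Rmax_r]).
    assert (Hdd : 0 < Rmin d (eps / Rmax K 1)).
    { apply Rmin_pos; [exact Hd|]. apply Rdiv_lt_0_compat; [apply eps|exact HK]. }
    exists (mkposreal _ Hdd). intros y Hy.
    change (Cmod (y - z0) < Rmin d (eps / Rmax K 1)) in Hy.
    change (Cmod ((f y - f z0) - (y - z0) * c1) <= eps * Cmod (y - z0)).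
    set (w := (y - z0)%C) in *.
    destruct (H w) as (e & He & E).
    { eapply Rlt_le_trans; [exact Hy|apply Rmin_l]. }
    assert (Ey : (z0 + (y - z0))%C = y) by (generalize (y : C); intros; ring).
    fold w in Ey. rewrite Ey in E.
    rewrite E. replace (f z0 + w * (c1 + w * e) - f z0 - w * c1)%C with (w * e * w)%C by ring.
    rewrite !Cmod_mult. apply Rmult_le_compat_r; [apply Cmod_ge_0|].
    apply Rle_trans with (Cmod w * Rmax K 1).
    + apply Rmult_le_compat_l; [apply Cmod_ge_0|].
      eapply Rle_trans; [exact He|apply Rmax_l].
    + apply Rlt_le. apply Rlt_le_trans with (eps / Rmax K 1 * Rmax K 1).
      * apply Rmult_lt_compat_r; [exact HK|]. eapply Rlt_le_trans; [exact Hy|apply Rmin_r].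
      * right. field. lra.
Qed.

(** * The maximum principle *)

(** Compactness of the closed disc, in the form: a property with a
    quantitative parameter [d] that holds locally holds with one [d] on the
    whole disc. *)
Lemma disc_uniform (rho : R) (P : R -> C -> Prop) :
  (forall d d' z, 0 < d' <= d -> P d z -> P d' z) ->
  (forall p, Cmod p <= rho -> exists d, 0 < d /\
     forall z, Cmod z <= rho -> Cmod (z - p) < d -> P d z) ->
  exists d, 0 < d /\ forall z, Cmod z <= rho -> P d z.
Proof.
  intros Hmono Hloc.
  assert (Hall : forall x y, exists d : posreal, forall z, Cmod z <= rho ->
            Cmod (z - (x, y)) < 2 * d -> P d z).
  { intros x y. destruct (Rle_lt_dec (Cmod (x, y)) rho) as [Hp|Hp].
    - destruct (Hloc _ Hp) as (d & Hd & H).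
      assert (Hd2 : 0 < d / 2) by lra.
      exists (mkposreal _ Hd2). simpl. intros z Hz Hzd.
      apply (Hmono d); [lra|]. apply H; [exact Hz|lra].
    (* The gauge must be defined on a whole square: around a point outside the
       disc it is so small that its neighbourhood misses the disc. *)
    - assert (Hd : 0 < (Cmod (x, y) - rho) / 2) by lra.
      exists (mkposreal _ Hd). simpl. intros z Hz Hzd. exfalso.
      assert (Cmod (x, y) <= Cmod z + Cmod (z - (x, y))); [|lra].
      replace (x, y) with (z + - (z - (x, y)))%C at 1 by ring.
      eapply Rle_trans; [apply Cmod_triangle|]. rewrite Cmod_opp. lra. }
  pose (delta := fun x y => proj1_sig (constructive_indefinite_description _ (Hall x y))).
  assert (Hdelta : forall x y z, Cmod z <= rho ->
            Cmod (z - (x, y)) < 2 * delta x y -> P (delta x y) z).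
  { intros x y. unfold delta.
    exact (proj2_sig (constructive_indefinite_description _ (Hall x y))). }
  destruct (compactness_value_2d (- rho) rho (- rho) rho delta) as [d Hd].
  exists d. split; [apply cond_pos|]. intros [x y] Hz.
  pose proof (Rmax_Cmod (x, y)) as Hmax. simpl in Hmax.
  pose proof (Rmax_l (Rabs x) (Rabs y)) as Hx. pose proof (Rmax_r (Rabs x) (Rabs y)) as Hy.
  apply NNPP. intros Hn. apply (Hd x y).
  - apply Rabs_le_between. lra.
  - apply Rabs_le_between. lra.
  - intros (u & v & _ & _ & Hu & Hv & Hduv). apply Hn.
    apply (Hmono (delta u v)); [split; [apply cond_pos|exact Hduv]|].
    apply Hdelta; [exact Hz|].
    assert (E : ((x, y) - (u, v))%C = (x - u, y - v)) by reflexivity.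
    rewrite E. eapply Rle_lt_trans; [apply Cmod_2Rmax|]. simpl.
    assert (Rmax (Rabs (x - u)) (Rabs (y - v)) < delta u v) by (apply Rmax_lub_lt; assumption).
    (* The covering is by squares; the factor 2 in the gauge absorbs the
       factor [sqrt 2] between the maximum norm and the modulus. *)
    assert (0 <= sqrt 2 < 2).
    { split; [apply sqrt_pos|]. 
      pose proof (sqrt_sqrt 2 ltac:(lra)). pose proof (sqrt_pos 2). nra. }
    pose proof (Rabs_pos (x - u)). pose proof (Rmax_l (Rabs (x - u)) (Rabs (y - v))).
    nra.
Qed.

Definition upper_continuous (u : C -> R) (p : C) : Prop :=
  forall eps, 0 < eps -> exists d, 0 < d /\
    forall z, Cmod (z - p) < d -> u z < u p + eps.

(** Two uses of [disc_uniform]: first with [u z <= / d], to see that [u] is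
    bounded above, and then, if the supremum [S] were not attained, with
    [u z <= S - d], which would contradict the choice of [S]. *)
Lemma disc_max_attained (u : C -> R) (rho : R) :
  0 <= rho -> (forall p, Cmod p <= rho -> upper_continuous u p) ->
  exists p, Cmod p <= rho /\ forall z, Cmod z <= rho -> u z <= u p.
Proof.
  intros Hrho Hu.
  destruct (disc_uniform rho (fun d z => u z <= / d)) as (d & Hd & Hb).
  { intros d d' z Hd H. eapply Rle_trans; [exact H|]. apply Rinv_le_contravar; lra. }
  { intros p Hp. destruct (Hu p Hp 1 Rlt_0_1) as (d & Hd & H).
    pose proof (Rabs_pos (u p)) as HA.
    assert (HB : 0 < / (Rabs (u p) + 1)) by (apply Rinv_0_lt_compat; lra).
    exists (Rmin d (/ (Rabs (u p) + 1))). split; [apply Rmin_pos; assumption|].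
    intros z _ Hz. 
    apply Rle_trans with (Rabs (u p) + 1).
    - apply Rlt_le. apply Rlt_le_trans with (u p + 1).
      + apply H. eapply Rlt_le_trans; [exact Hz|apply Rmin_l].
      + pose proof (Rle_abs (u p)). lra.
    - rewrite <- (Rinv_inv (Rabs (u p) + 1)) at 1.
      apply Rinv_le_contravar; [apply Rmin_pos; assumption|apply Rmin_r]. }
  destruct (completeness (fun y => exists z, Cmod z <= rho /\ y = u z)) as [S [HS1 HS2]].
  { exists (/ d). intros y (z & Hz & ->). apply Hb, Hz. }
  { exists (u 0%C), 0%C. rewrite Cmod_0. split; [exact Hrho|reflexivity]. }
  apply NNPP. intros Hn.
  assert (Hlt : forall p, Cmod p <= rho -> u p < S).
  { intros p Hp. destruct (Rlt_le_dec (u p) S) as [|Hge]; [assumption|].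
    exfalso. apply Hn. exists p. split; [exact Hp|]. intros z Hz.
    eapply Rle_trans; [apply HS1; exists z; split; [exact Hz|reflexivity]|exact Hge]. }
  destruct (disc_uniform rho (fun d z => u z <= S - d)) as (d' & Hd' & Hb').
  { intros e e' z He H. lra. }
  { intros p Hp. pose proof (Hlt p Hp) as Hlp.
    destruct (Hu p Hp ((S - u p) / 2)) as (e & He & H); [lra|].
    exists (Rmin e ((S - u p) / 2)). split; [apply Rmin_pos; lra|].
    intros z _ Hz. 
    assert (u z < u p + (S - u p) / 2).
    { apply H. eapply Rlt_le_trans; [exact Hz|apply Rmin_l]. }
    pose proof (Rmin_r e ((S - u p) / 2)). lra. }
  assert (S <= S - d'); [|lra].
  apply HS2. intros y (z & Hz & ->). apply Hb', Hz.
Qed.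

Lemma jet2_upper_continuous g p eps :
  jet2 g p -> upper_continuous (fun z => Cmod (g z) ^ 2 + eps * Cmod z ^ 2) p.
Proof.
  intros (c1 & c2 & K & d & Hd & H) e He.
  (* [L] bounds the slope of [g] within distance 1 of [p], and [B] that of the
     whole function, with 1 added to make it positive. *)
  set (L := Cmod c1 + Cmod c2 + Rabs K).
  set (G := Cmod (g p)). set (A := Cmod p).
  assert (HL : 0 <= L).
  { unfold L. pose proof (Cmod_ge_0 c1). pose proof (Cmod_ge_0 c2). pose proof (Rabs_pos K). lra. }
  assert (HG : 0 <= G) by apply Cmod_ge_0. assert (HA : 0 <= A) by apply Cmod_ge_0.
  set (B := 2 * G * L + L * L + Rabs eps * (2 * A + 1) + 1).
  assert (HB : 0 < B).
  { unfold B. pose proof (Rabs_pos eps). 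
    assert (0 <= G * L) by (apply Rmult_le_pos; assumption).
    assert (0 <= L * L) by (apply Rmult_le_pos; assumption).
    assert (0 <= Rabs eps * (2 * A + 1)) by (apply Rmult_le_pos; lra). lra. }
  exists (Rmin (Rmin d 1) (e / B)).
  assert (HeB : 0 < e / B) by (apply Rdiv_lt_0_compat; assumption).
  split; [repeat apply Rmin_pos; lra|].
  intros z Hz. 
  pose proof (Rmin_l (Rmin d 1) (e / B)). pose proof (Rmin_r (Rmin d 1) (e / B)).
  pose proof (Rmin_l d 1). pose proof (Rmin_r d 1).
  set (w := (z - p)%C) in *.
  destruct (H w) as (r & Hr & E); [lra|].
  replace (p + w)%C with z in E by (unfold w; ring).
  set (s := Cmod w) in *. assert (Hs : 0 <= s) by apply Cmod_ge_0.
  assert (Hg : Cmod (g z) <= G + s * L).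
  { rewrite E. eapply Rle_trans; [apply Cmod_triangle|]. rewrite Cmod_mult. fold s G.
    apply Rplus_le_compat_l, Rmult_le_compat_l; [exact Hs|].
    eapply Rle_trans; [apply Cmod_triangle|]. rewrite Cmod_mult. fold s. unfold L.
    rewrite Rplus_assoc. apply Rplus_le_compat_l.
    assert (Cmod (c2 + w * r) <= Cmod c2 + Rabs K).
    { eapply Rle_trans; [apply Cmod_triangle|]. rewrite Cmod_mult. fold s.
      pose proof (Rle_abs K). pose proof (Cmod_ge_0 r). nra. }
    pose proof (Cmod_ge_0 (c2 + w * r)). nra. }
  assert (Hzz : Rabs (Cmod z ^ 2 - A ^ 2) <= s * (2 * A + 1)).
  { assert (HA1 : Cmod z <= A + s).
    { replace z with (p + w)%C by (unfold w; ring). apply Cmod_triangle. }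
    assert (HA2 : A <= Cmod z + s).
    { unfold A. replace p with (z + - w)%C by (unfold w; ring).
      eapply Rle_trans; [apply Cmod_triangle|]. rewrite Cmod_opp. fold s. lra. }
    pose proof (Cmod_ge_0 z). apply Rabs_le. split; nra. }
  assert (Heps : eps * Cmod z ^ 2 - eps * A ^ 2 <= Rabs eps * (s * (2 * A + 1))).
  { replace (eps * Cmod z ^ 2 - eps * A ^ 2) with (eps * (Cmod z ^ 2 - A ^ 2)) by ring.
    eapply Rle_trans; [apply Rle_abs|]. rewrite Rabs_mult.
    apply Rmult_le_compat_l; [apply Rabs_pos|exact Hzz]. }
  assert (Hg2 : Cmod (g z) ^ 2 <= G ^ 2 + s * (2 * G * L + L * L)).
  { pose proof (Cmod_ge_0 (g z)).
    apply Rle_trans with ((G + s * L) ^ 2); [apply pow_incr; split; assumption|].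
    assert (0 <= s * (1 - s) * (L * L)).
    { apply Rmult_le_pos; [apply Rmult_le_pos; lra|]. apply Rmult_le_pos; assumption. }
    nra. }
  assert (Hfin : s * B < e).
  { replace e with (e / B * B) by (field; lra). apply Rmult_lt_compat_r; lra. }
  assert (HsB : s * B = s * (2 * G * L + L * L) + Rabs eps * (s * (2 * A + 1)) + s).
  { unfold B. ring. }
  lra.
Qed.

(** If [e <= p], then [q^2 >= (p - e)^2 >= p^2 - 2 p e]; if [e > p], the left
    side is not positive, as [B K >= p e >= p^2]. *)
Lemma square_perturbation (p e K B : R) (q : R) :
  0 <= p <= B -> 0 <= e <= K -> 0 <= q -> p <= q + e -> p ^ 2 - 2 * B * K <= q ^ 2.
Proof.
  intros. assert (p * e <= B * K) by (apply Rmult_le_compat; lra).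
  destruct (Rle_lt_dec e p); nra.
Qed.

(** At [s, - s, i s, - i s] the sums of [w], [w^2] and of [w] times the
    conjugate of [w^2] vanish, so by Parseval the mean of [|P|^2] is
    [|c0|^2 + |c1|^2 s^2 + |c2|^2 s^4]. *)
Lemma four_point_mean (c0 c1 c2 : C) (s : R) :
  let P := fun w : C => (c0 + w * (c1 + w * c2))%C in
  4 * Cmod c0 ^ 2 <=
    Cmod (P (s, 0)) ^ 2 + Cmod (P (- s, 0)) ^ 2 + Cmod (P (0, s)) ^ 2 + Cmod (P (0, - s)) ^ 2.
Proof.
  intros P. unfold P. rewrite !Cmod2_alt.
  destruct c0 as [a0 b0], c1 as [a1 b1], c2 as [a2 b2]. unfold Re, Im. simpl.
  assert (0 <= s ^ 2 * (a1 ^ 2 + b1 ^ 2) + s ^ 4 * (a2 ^ 2 + b2 ^ 2)).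
  { assert (0 <= s ^ 4) by (replace (s ^ 4) with ((s ^ 2) ^ 2) by ring; apply pow2_ge_0).
    pose proof (pow2_ge_0 s). pose proof (pow2_ge_0 a1). pose proof (pow2_ge_0 b1).
    pose proof (pow2_ge_0 a2). pose proof (pow2_ge_0 b2).
    apply Rplus_le_le_0_compat; apply Rmult_le_pos; lra. }
  match goal with |- ?l <= ?r => 
    replace r with (l + 4 * (s ^ 2 * (a1 ^ 2 + b1 ^ 2) + s ^ 4 * (a2 ^ 2 + b2 ^ 2))) by ring end.
  lra.
Qed.

(** Over the four points the mean of [eps |z|^2] gains [eps s^2], while the
    Taylor remainder can cost only [O(s^3)]; a small [s] makes the gain win. *)
Lemma no_interior_max g p eps t :
  0 < eps -> 0 < t -> jet2 g p ->
  ~ (forall w, Cmod w < t ->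
       Cmod (g (p + w)%C) ^ 2 + eps * Cmod (p + w) ^ 2 <= Cmod (g p) ^ 2 + eps * Cmod p ^ 2).
Proof.
  intros Heps Ht (c1 & c2 & K & d & Hd & H) Hmax.
  assert (HK : 0 <= K).
  { destruct (H 0%C) as (e & He & _); [rewrite Cmod_0; exact Hd|].
    pose proof (Cmod_ge_0 e). lra. }
  set (B := Cmod (g p) + Cmod c1 + Cmod c2 + 1).
  pose proof (Cmod_ge_0 (g p)). pose proof (Cmod_ge_0 c1). pose proof (Cmod_ge_0 c2).
  assert (HB : 1 <= B) by (unfold B; lra).
  (* Adding up the four inequalities of a maximum gives [eps <= 2 B K s], which
     the last entry of this minimum excludes. *)
  set (s := Rmin (Rmin (t / 2) (d / 2)) (Rmin 1 (eps / (4 * (B * (K + 1)))))).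
  assert (HBK : 0 < 4 * (B * (K + 1))) by (assert (0 < B * (K + 1)) by (apply Rmult_lt_0_compat; lra); lra).
  assert (Hs : 0 < s).
  { unfold s. repeat apply Rmin_pos; try lra. apply Rdiv_lt_0_compat; lra. }
  assert (Hs1 : s <= t / 2) by (unfold s; eapply Rle_trans; [apply Rmin_l|apply Rmin_l]).
  assert (Hs2 : s <= d / 2) by (unfold s; eapply Rle_trans; [apply Rmin_l|apply Rmin_r]).
  assert (Hs3 : s <= 1) by (unfold s; eapply Rle_trans; [apply Rmin_r|apply Rmin_l]).
  assert (Hs4 : s * (4 * (B * (K + 1))) <= eps).
  { apply Rle_trans with (eps / (4 * (B * (K + 1))) * (4 * (B * (K + 1)))).
    - apply Rmult_le_compat_r; [lra|]. unfold s. eapply Rle_trans; [apply Rmin_r|apply Rmin_r].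
    - right. field. lra. }
  set (P := fun w : C => (g p + w * (c1 + w * c2))%C).
  assert (Hpt : forall w, Cmod w = s ->
    Cmod (P w) ^ 2 + eps * Cmod (p + w) ^ 2 <=
    Cmod (g p) ^ 2 + eps * Cmod p ^ 2 + 2 * B * (s ^ 3 * K)).
  { intros w Hw. specialize (Hmax w). destruct (H w) as (e & He & E); [lra|].
    assert (Cmod (P w) ^ 2 - 2 * B * (s ^ 3 * K) <= Cmod (g (p + w)%C) ^ 2).
    { apply square_perturbation with (e := Cmod (w * w * w * e)).
      - split; [apply Cmod_ge_0|]. unfold P.
        eapply Rle_trans; [apply Cmod_triangle|]. rewrite Cmod_mult, Hw.
        assert (Cmod (c1 + w * c2) <= Cmod c1 + Cmod c2).
        { eapply Rle_trans; [apply Cmod_triangle|]. rewrite Cmod_mult, Hw. nra. }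
        pose proof (Cmod_ge_0 (c1 + w * c2)). unfold B. nra.
      - split; [apply Cmod_ge_0|]. rewrite !Cmod_mult, Hw.
        replace (s ^ 3 * K) with (s * s * s * K) by ring.
        apply Rmult_le_compat_l; [|exact He]. 
        apply Rmult_le_pos; [apply Rmult_le_pos|]; lra.
      - apply Cmod_ge_0.
      - rewrite E. unfold P.
        replace (g p + w * (c1 + w * c2))%C with
          ((g p + w * (c1 + w * (c2 + w * e))) + - (w * w * w * e))%C by ring.
        eapply Rle_trans; [apply Cmod_triangle|]. rewrite Cmod_opp. lra. }
    specialize (Hmax ltac:(lra)). lra. }
  assert (Hax : forall a b, a ^ 2 + b ^ 2 = s ^ 2 -> Cmod (a, b) = s).
  { intros a b E. unfold Cmod. simpl fst. simpl snd. rewrite E. apply sqrt_pow2. lra. }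
  pose proof (Hpt (s, 0) (Hax s 0 ltac:(ring))) as Q1.
  pose proof (Hpt (- s, 0) (Hax (- s) 0 ltac:(ring))) as Q2.
  pose proof (Hpt (0, s) (Hax 0 s ltac:(ring))) as Q3.
  pose proof (Hpt (0, - s) (Hax 0 (- s) ltac:(ring))) as Q4.
  pose proof (four_point_mean (g p) c1 c2 s) as Q. cbv zeta in Q. fold P in Q. 
  change (4 * Cmod (g p) ^ 2 <=
    Cmod (P (s, 0)) ^ 2 + Cmod (P (- s, 0)) ^ 2 + Cmod (P (0, s)) ^ 2 + Cmod (P (0, - s)) ^ 2) in Q.
  assert (Hz : Cmod (p + (s, 0)) ^ 2 + Cmod (p + (- s, 0)) ^ 2 + Cmod (p + (0, s)) ^ 2
     + Cmod (p + (0, - s)) ^ 2 = 4 * Cmod p ^ 2 + 4 * s ^ 2).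
  { rewrite !Cmod2_alt. destruct p as [x y]. unfold Re, Im. simpl. ring. }
  assert (Hc : eps * s ^ 2 <= 2 * B * (s ^ 3 * K)).
  { assert (eps * (Cmod (p + (s, 0)) ^ 2 + Cmod (p + (- s, 0)) ^ 2 + Cmod (p + (0, s)) ^ 2
     + Cmod (p + (0, - s)) ^ 2) = eps * (4 * Cmod p ^ 2 + 4 * s ^ 2)) by (rewrite Hz; reflexivity).
    lra. }
  assert (0 < s ^ 2) by (apply pow_lt; exact Hs).
  assert (eps <= 2 * B * s * K).
  { apply Rmult_le_reg_r with (s ^ 2); [assumption|]. 
    replace (2 * B * s * K * s ^ 2) with (2 * B * (s ^ 3 * K)) by ring. exact Hc. }
  assert (0 <= s * B * K) by (apply Rmult_le_pos; [apply Rmult_le_pos|]; lra).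
  assert (0 < s * B) by (apply Rmult_lt_0_compat; lra).
  nra.
Qed.

(** The maximum of [|g|^2 + eps |z|^2] lies on the boundary circle, so
    [|g z|^2 <= M^2 + eps rho^2] for every [eps > 0]. *)
Lemma maximum_principle g rho M :
  0 < rho -> 0 <= M ->
  (forall z, Cmod z <= rho -> jet2 g z) ->
  (forall z, Cmod z = rho -> Cmod (g z) <= M) ->
  forall z, Cmod z <= rho -> Cmod (g z) <= M.
Proof.
  intros Hrho HM Hg Hbd z Hz.
  assert (Hsq : forall eps, 0 < eps -> Cmod (g z) ^ 2 <= M ^ 2 + eps * rho ^ 2).
  { intros eps Heps.
    destruct (disc_max_attained (fun z => Cmod (g z) ^ 2 + eps * Cmod z ^ 2) rho) as (p & Hp & Hmax).
    - lra.
    - intros p Hp. apply jet2_upper_continuous, Hg, Hp.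
    - destruct (Req_dec (Cmod p) rho) as [E|E].
      + pose proof (Hmax z Hz) as Hm. simpl in Hm.
        assert (Cmod (g p) ^ 2 <= M ^ 2).
        { apply pow_incr. split; [apply Cmod_ge_0|]. apply Hbd, E. }
        rewrite E in Hm. 
        assert (0 <= eps * Cmod z ^ 2) by (apply Rmult_le_pos; [lra|apply pow2_ge_0]).
        simpl in *. lra.
      + exfalso. apply (no_interior_max g p eps (rho - Cmod p)); [exact Heps|lra|apply Hg, Hp|].
        intros w Hw. apply Hmax. eapply Rle_trans; [apply Cmod_triangle|]. lra. }
  destruct (Rle_lt_dec (Cmod (g z)) M) as [|Hlt]; [assumption|exfalso].
  assert (Hd : 0 < Cmod (g z) ^ 2 - M ^ 2) by nra.
  assert (Hr2 : 0 < rho ^ 2) by (apply pow_lt; exact Hrho).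
  specialize (Hsq ((Cmod (g z) ^ 2 - M ^ 2) / (2 * rho ^ 2))).
  assert (Cmod (g z) ^ 2 <= M ^ 2 + (Cmod (g z) ^ 2 - M ^ 2) / (2 * rho ^ 2) * rho ^ 2).
  { apply Hsq. apply Rdiv_lt_0_compat; lra. }
  replace ((Cmod (g z) ^ 2 - M ^ 2) / (2 * rho ^ 2) * rho ^ 2)
    with ((Cmod (g z) ^ 2 - M ^ 2) / 2) in * by (field; lra).
  lra.
Qed.

(** * The Schwarz lemma *)

Lemma jet2_ext_near (f g : C -> C) z0 d :
  0 < d -> (forall z, Cmod (z - z0) < d -> f z = g z) -> jet2 f z0 -> jet2 g z0.
Proof.
  intros Hd E (c1 & c2 & K & d' & Hd' & H).
  exists c1, c2, K, (Rmin d d'). split; [apply Rmin_pos; assumption|].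
  intros w Hw. pose proof (Rmin_l d d'). pose proof (Rmin_r d d').
  destruct (H w) as (e & He & Ew); [lra|]. exists e. split; [exact He|].
  rewrite <- !E; [exact Ew| |].
  - replace (z0 - z0)%C with (RtoC 0) by ring. rewrite Cmod_0. exact Hd.
  - replace (z0 + w - z0)%C with w by ring. lra.
Qed.

(** The coefficients of [f z / z] at [z0 <> 0] solve
    [(c0 + c1 w + c2 w^2) (z0 + w) = b0 + b1 w + b2 w^2 + O(w^3)]; the
    remainder that is left is divided by [z0 + w], of modulus at least
    [|z0| / 2]. *)
Lemma jet2_div_id (f : C -> C) z0 :
  z0 <> RtoC 0 -> jet2 f z0 -> jet2 (fun z => f z / z)%C z0.
Proof.
  intros Hz0 (b1 & b2 & K & d & Hd & H).
  assert (Hm : 0 < Cmod z0) by (apply Cmod_gt_0; exact Hz0).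
  set (c0 := (f z0 / z0)%C). set (c1 := ((b1 - c0) / z0)%C). set (c2 := ((b2 - c1) / z0)%C).
  exists c1, c2, ((K + Cmod c2) / (Cmod z0 / 2)), (Rmin d (Cmod z0 / 2)).
  split; [apply Rmin_pos; lra|].
  intros w Hw. pose proof (Rmin_l d (Cmod z0 / 2)). pose proof (Rmin_r d (Cmod z0 / 2)).
  destruct (H w) as (e & He & E); [lra|].
  assert (Hlow : Cmod z0 / 2 <= Cmod (z0 + w)).
  { assert (Cmod z0 <= Cmod (z0 + w) + Cmod w); [|lra].
    replace z0 with ((z0 + w) + - w)%C at 1 by ring.
    eapply Rle_trans; [apply Cmod_triangle|]. rewrite Cmod_opp. lra. }
  assert (Hne : (z0 + w)%C <> RtoC 0) by (apply Cmod_gt_0; lra).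
  exists ((e - c2) / (z0 + w))%C. split.
  - rewrite Cmod_div by exact Hne. unfold Rdiv.
    apply Rmult_le_compat.
    + apply Cmod_ge_0.
    + left. apply Rinv_0_lt_compat. lra.
    + unfold Cminus. eapply Rle_trans; [apply Cmod_triangle|]. rewrite Cmod_opp. lra.
    + apply Rinv_le_contravar; lra.
  - rewrite E. unfold c2, c1, c0. field. split; assumption.
Qed.

(** On the circle of radius [rho < 1] the quotient [w z / z], extended to [0]
    by its power series, is bounded by [1 / rho]; the maximum principle
    carries the bound inside, and [rho] tends to [1]. *)
Lemma schwarz_lemma (w : C -> C) :
  analytic_on Delta w -> (forall z, Delta z -> Delta (w z)) -> w 0%C = 0%C ->
  forall z, Delta z -> Cmod (w z) <= Cmod z.
Proof.
  intros Hw Hmap Hw0.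
  assert (HD0 : Delta 0%C) by (unfold Delta; rewrite Cmod_0; lra).
  destruct (expansion_of_analytic _ _ _ Hw HD0) as (rho0 & a & Hrho0 & Ha).
  destruct (expansion_peel _ _ _ _ Hrho0 Ha) as (g & Hg & Eg).
  rewrite <- (expansion_center _ _ _ _ Hrho0 Ha), Hw0 in Eg.
  pose (phi := fun z : C => if excluded_middle_informative (z = RtoC 0) then g 0%C else (w z / z)%C).
  assert (Ephi : forall z, z <> RtoC 0 -> phi z = (w z / z)%C).
  { intros z Hz. unfold phi. destruct (excluded_middle_informative _); [contradiction|reflexivity]. }
  assert (Hjet : forall z, Delta z -> jet2 phi z).
  { intros z Hz. destruct (classic (z = RtoC 0)) as [->|Hz0].
    - apply jet2_ext_near with g rho0; [exact Hrho0| |exact (expansion_jet2 _ _ _ _ Hrho0 Hg)].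
      intros z Hzr. unfold phi. 
      destruct (excluded_middle_informative _) as [->|Hz0]; [reflexivity|].
      replace (z - 0)%C with z in Hzr by ring.
      pose proof (Eg z Hzr) as E. rewrite Cplus_0_l in E. rewrite E. field. exact Hz0.
    - destruct (expansion_of_analytic _ _ _ Hw Hz) as (rho & b & Hrho & Hb).
      apply jet2_ext_near with (fun z => w z / z)%C (Cmod z).
      + apply Cmod_gt_0, Hz0.
      + intros y Hy. symmetry. apply Ephi. intros ->. revert Hy.
        replace (0 - z)%C with (- z)%C by ring. rewrite Cmod_opp. lra.
      + apply jet2_div_id; [exact Hz0|]. exact (expansion_jet2 _ _ _ _ Hrho Hb). }
  intros z Hz. destruct (classic (z = RtoC 0)) as [->|Hz0].
  { rewrite Hw0. lra. }
  assert (Hzp : 0 < Cmod z) by (apply Cmod_gt_0, Hz0).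
  unfold Delta in Hz.
  assert (Hrho : forall rho, Cmod z <= rho < 1 -> rho * Cmod (w z) <= Cmod z).
  { intros rho Hr.
    assert (Cmod (phi z) <= / rho).
    { apply maximum_principle with rho; try lra.
      - left. apply Rinv_0_lt_compat. lra.
      - intros y Hy. apply Hjet. unfold Delta. lra.
      - intros y Hy. assert (Hy0 : y <> RtoC 0) by (apply Cmod_gt_0; lra).
        rewrite Ephi by exact Hy0. rewrite Cmod_div, Hy by exact Hy0.
        assert (Hwy : Delta (w y)) by (apply Hmap; unfold Delta; lra). unfold Delta in Hwy.
        unfold Rdiv. rewrite <- (Rmult_1_l (/ rho)) at 2.
        apply Rmult_le_compat_r; [left; apply Rinv_0_lt_compat|]; lra. }
    rewrite Ephi, Cmod_div in H by exact Hz0.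
    apply Rmult_le_reg_r with (/ rho * / Cmod z).
    { apply Rmult_lt_0_compat; apply Rinv_0_lt_compat; lra. }
    replace (rho * Cmod (w z) * (/ rho * / Cmod z)) with (Cmod (w z) / Cmod z) by (field; lra).
    replace (Cmod z * (/ rho * / Cmod z)) with (/ rho) by (field; lra). exact H. }
  destruct (Rle_lt_dec (Cmod (w z)) (Cmod z)) as [|Hlt]; [assumption|exfalso].
  (* If [|w z| > |z|], then [Hrho] fails for every [rho] between [m] and 1. *)
  set (m := Cmod z / Cmod (w z)).
  assert (Hm : m * Cmod (w z) = Cmod z) by (unfold m; field; lra).
  assert (Hm1 : m < 1) by (apply Rmult_lt_reg_r with (Cmod (w z)); lra).
  pose proof (Rmax_l (Cmod z) ((1 + m) / 2)). pose proof (Rmax_r (Cmod z) ((1 + m) / 2)).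
  assert (Rmax (Cmod z) ((1 + m) / 2) < 1) by (apply Rmax_lub_lt; lra).
  specialize (Hrho (Rmax (Cmod z) ((1 + m) / 2)) ltac:(lra)). nra.
Qed.

(** * Bounds for the real part of the majorant *)

(** The upper bound is one for the modulus.  The lower bound amounts to
    [(r + Re w) (1 - r) >= 0]. *)
Lemma Re_inv_bounds (w : C) r :
  Cmod w <= r -> r < 1 -> / (1 + r) <= Re (/ (1 - w))%C <= / (1 - r).
Proof.
  intros Hw Hr. pose proof (Cmod_ge_0 w) as H0.
  assert (H1 : 1 - r <= Cmod (1 - w)).
  { assert (1 <= Cmod (1 - w) + Cmod w); [|lra].
    apply Rle_trans with (Cmod ((1 - w) + w)%C); [|apply Cmod_triangle].
    replace (1 - w + w)%C with (RtoC 1) by ring. rewrite Cmod_1. lra. }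
  assert (Hne : (1 - w)%C <> RtoC 0) by (apply Cmod_gt_0; lra).
  split.
  - assert (H2 : Cmod w ^ 2 <= r ^ 2) by (apply pow_incr; lra).
    assert (H3 : (1 - r) ^ 2 <= Cmod (1 - w) ^ 2) by (apply pow_incr; lra).
    assert (H4 : Rabs (Re w) <= r) by (eapply Rle_trans; [apply re_le_Cmod|exact Hw]).
    apply Rabs_le_between in H4.
    rewrite Cmod2_alt in H2, H3. destruct w as [x y]. unfold Re, Im in *. simpl in *.
    replace (1 + - x) with (1 - x) in * by ring. replace (0 + - y) with (- y) in * by ring.
    set (N := (1 - x) * ((1 - x) * 1) + - y * (- y * 1)) in *.
    assert (HN : 0 < N) by nra.
    apply Rmult_le_reg_r with (N * (1 + r)); [nra|].
    replace (/ (1 + r) * (N * (1 + r))) with N by (field; lra).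
    replace ((1 - x) / N * (N * (1 + r))) with ((1 - x) * (1 + r)) by (field; lra).
    unfold N. nra.
  - eapply Rle_trans; [apply Rle_abs|]. eapply Rle_trans; [apply re_le_Cmod|].
    rewrite Cmod_inv by exact Hne. apply Rinv_le_contravar; lra.
Qed.

(** The difference of the bounds for [1 / (1 - w)] and [1 / (1 + beta w)] is
    sharp, because the first is largest and the second smallest at the same
    point [w = r], and conversely at [w = - r]. *)
Lemma Re_h_cs_bounds beta (w : C) r :
  0 <= beta < 1 -> Cmod w <= r -> 0 <= r < 1 ->
  - r / ((1 + r) * (1 - beta * r)) <= Re (h_cs beta w) <= r / ((1 - r) * (1 + beta * r)).
Proof.
  intros Hb Hw Hr.
  assert (Hbw : Cmod (- (beta * w))%C <= beta * r).
  { rewrite Cmod_opp, Cmod_mult, Cmod_R, Rabs_pos_eq by lra. apply Rmult_le_compat_l; lra. }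
  assert (Hbr : 0 <= beta * r < 1) by nra.
  pose proof (Re_inv_bounds _ _ Hw ltac:(lra)) as B1.
  pose proof (Re_inv_bounds _ _ Hbw ltac:(lra)) as B2.
  assert (Hne : forall v r', Cmod v <= r' -> r' < 1 -> (1 - v)%C <> RtoC 0).
  { intros v r' Hv Hr' E. assert (v = RtoC 1) as ->.
    { replace v with (1 - (1 - v))%C by ring. rewrite E. ring. }
    rewrite Cmod_1 in Hv. lra. }
  assert (E : h_cs beta w = (RtoC (/ (1 + beta)) * (/ (1 - w) - / (1 - - (beta * w))))%C).
  { unfold h_cs. rewrite RtoC_inv, RtoC_plus by lra.
    assert (N1 : (1 - w)%C <> RtoC 0) by (apply (Hne w r); lra).
    assert (N2 : (1 - - (beta * w))%C <> RtoC 0) by (apply (Hne _ _ Hbw); lra).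
    assert (N3 : (RtoC 1 + beta)%C <> RtoC 0).
    { rewrite <- RtoC_plus. intros E. apply RtoC_inj in E. lra. }
    replace (1 + beta * w)%C with (1 - - (beta * w))%C by ring.
    field. repeat split; assumption. }
  assert (E' : Re (h_cs beta w) = / (1 + beta) * (Re (/ (1 - w))%C - Re (/ (1 - - (beta * w)))%C)).
  { rewrite E. unfold Re, Im. simpl. ring. }
  rewrite E'.
  assert (Hib : 0 < / (1 + beta)) by (apply Rinv_0_lt_compat; lra).
  split.
  - replace (- r / ((1 + r) * (1 - beta * r))) with (/ (1 + beta) * (/ (1 + r) - / (1 - beta * r))).
    + apply Rmult_le_compat_l; lra.
    + field. lra.
  - replace (r / ((1 - r) * (1 + beta * r))) with (/ (1 + beta) * (/ (1 - r) - / (1 + beta * r))).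
    + apply Rmult_le_compat_l; lra.
    + field. lra.
Qed.

(** * The squared modulus along a ray *)

Lemma is_derive_of_quadratic_bound (u : R -> R) t l A d :
  0 < d -> (forall h, Rabs h < d -> Rabs (u (t + h) - u t - h * l) <= A * h ^ 2) ->
  is_derive u t l.
Proof.
  intros Hd H. apply is_derive_Reals. intros eps Heps.
  pose proof (Rabs_pos A) as HA. pose proof (Rle_abs A).
  assert (Hm : 0 < Rmin d (eps / (Rabs A + 1))).
  { apply Rmin_pos; [exact Hd|]. apply Rdiv_lt_0_compat; lra. }
  exists (mkposreal _ Hm). intros h Hh0 Hh. simpl in Hh.
  pose proof (Rmin_l d (eps / (Rabs A + 1))). pose proof (Rmin_r d (eps / (Rabs A + 1))).
  specialize (H h ltac:(lra)).
  assert (Hhp : 0 < Rabs h) by (apply Rabs_pos_lt; exact Hh0).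
  replace ((u (t + h) - u t) / h - l) with ((u (t + h) - u t - h * l) / h) by (field; exact Hh0).
  unfold Rdiv. rewrite Rabs_mult, Rabs_inv.
  apply Rmult_lt_reg_r with (Rabs h); [exact Hhp|].
  rewrite Rmult_assoc, Rinv_l, Rmult_1_r by lra.
  eapply Rle_lt_trans; [exact H|].
  rewrite <- pow2_abs.
  assert (Rabs h * (Rabs A + 1) < eps).
  { apply Rlt_le_trans with (eps / (Rabs A + 1) * (Rabs A + 1)).
    - apply Rmult_lt_compat_r; lra.
    - right. field. lra. }
  nra.
Qed.

Lemma is_derive_sqmod_along_ray (f : C -> C) (e c1 : C) (t : R) :
  Cmod e = 1 -> jet1 f (t * e)%C c1 ->
  is_derive (fun s : R => Cmod (f (s * e)%C) ^ 2) t
            (2 * Re (Cconj (f (t * e)%C) * (e * c1))%C).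
Proof.
  intros He (K & d & Hd & H).
  assert (Hx : forall h, Rabs h < d -> exists v : C, Cmod v <= K /\
     f (RtoC (t + h) * e)%C = (f (t * e) + h * (e * c1) + RtoC (h ^ 2) * v)%C).
  { intros h Hh. destruct (H (h * e)%C) as (v & Hv & E).
    - rewrite Cmod_mult, Cmod_R, He. lra.
    - exists (e * e * v)%C. split.
      + rewrite !Cmod_mult, He. lra.
      + replace (RtoC (t + h) * e)%C with (t * e + h * e)%C by (rewrite RtoC_plus; ring).
        rewrite E, RtoC_pow. simpl. ring. }
  assert (D1 : is_derive (fun s : R => Re (f (s * e)%C)) t (Re (e * c1)%C)).
  { apply is_derive_of_quadratic_bound with K d; [exact Hd|].
    intros h Hh. destruct (Hx h Hh) as (v & Hv & ->).
    match goal with |- Rabs ?x <= _ => replace x with (h ^ 2 * Re v) by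
      (destruct v, e, c1, (f (t * (r1, r2))%C); unfold Re, Im; simpl; ring) end.
    rewrite Rabs_mult, (Rabs_pos_eq (h ^ 2)) by apply pow2_ge_0.
    rewrite Rmult_comm. apply Rmult_le_compat_r; [apply pow2_ge_0|].
    eapply Rle_trans; [apply re_le_Cmod|exact Hv]. }
  assert (D2 : is_derive (fun s : R => Im (f (s * e)%C)) t (Im (e * c1)%C)).
  { apply is_derive_of_quadratic_bound with K d; [exact Hd|].
    intros h Hh. destruct (Hx h Hh) as (v & Hv & ->).
    match goal with |- Rabs ?x <= _ => replace x with (h ^ 2 * Im v) by
      (destruct v, e, c1, (f (t * (r1, r2))%C); unfold Re, Im; simpl; ring) end.
    rewrite Rabs_mult, (Rabs_pos_eq (h ^ 2)) by apply pow2_ge_0.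
    rewrite Rmult_comm. apply Rmult_le_compat_r; [apply pow2_ge_0|].
    eapply Rle_trans; [|exact Hv]. eapply Rle_trans; [apply Rmax_r|apply Rmax_Cmod]. }
  apply is_derive_ext with (fun s : R => Re (f (s * e)%C) ^ 2 + Im (f (s * e)%C) ^ 2).
  { intros s. symmetry. apply Cmod2_alt. }
  evar_last.
  { apply (is_derive_plus (V := R_NormedModule)); apply is_derive_pow; [exact D1|exact D2]. }
  unfold plus. simpl. destruct (f (t * e)%C), (e * c1)%C. unfold Re, Im. simpl. ring.
Qed.

(** * Integrating the differential inequality *)

(** The sign [sigma], equal to [1] or [-1] in the applications, treats the
    increasing and the decreasing case at once. *)
Lemma monotone_of_derive_sign (Q dQ : R -> R) (sigma a b : R) :
  a <= b -> (forall t, a <= t <= b -> is_derive Q t (dQ t)) ->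
  (forall t, a <= t <= b -> sigma * dQ t <= 0) -> sigma * Q b <= sigma * Q a.
Proof.
  intros Hab HQ Hs.
  destruct (MVT_gen Q a b dQ) as (c & Hc & E).
  - intros t Ht. apply HQ. rewrite Rmin_left, Rmax_right in Ht by exact Hab. lra.
  - intros t Ht. rewrite Rmin_left, Rmax_right in Ht by exact Hab.
    apply derivable_continuous_pt. exists (dQ t). apply is_derive_Reals, HQ, Ht.
  - rewrite Rmin_left, Rmax_right in Hc by exact Hab. pose proof (Hs c Hc). nra.
Qed.

Lemma continuous_filterlim_at_right (u : R -> R) (x : R) :
  continuous u x -> filterlim u (at_right x) (locally (u x)).
Proof.
  intros Hu V HV. destruct (Hu V HV) as [d Hd].
  exists d. intros y Hy _. exact (Hd y Hy).
Qed.

(** The function [Q t = P t / t^2 * exp (- 2 H t)] satisfies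
    [Q' = 2 Q (kappa - t eta) / t], so [sigma Q] is nonincreasing, and [Q] has
    limit [1] at [0].  The product form of the hypothesis on [P'] allows zeros of [P]. *)
Lemma growth_comparison (sigma : R) (P H kappa eta : R -> R) :
  (forall t, 0 < t < 1 -> 0 <= P t) ->
  (forall t, 0 < t < 1 -> is_derive P t (2 * P t * (1 + kappa t) / t)) ->
  (forall t, 0 <= t < 1 -> is_derive H t (eta t)) ->
  H 0 = 0 ->
  filterlim (fun t => P t / t ^ 2) (at_right 0) (locally 1) ->
  (forall t, 0 < t < 1 -> sigma * (kappa t - t * eta t) <= 0) ->
  forall r, 0 < r < 1 -> sigma * P r <= sigma * (r * exp (H r)) ^ 2.
Proof.
  intros HP HdP HdH H0 Hlim Hs r Hr.
  pose (Q := fun t => P t / t ^ 2 * exp (- 2 * H t)).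
  assert (HQ : forall t, 0 < t < 1 ->
     is_derive Q t (2 * (P t / t ^ 2 * exp (- 2 * H t)) / t * (kappa t - t * eta t))).
  { intros t Ht. unfold Q.
    pose proof (HdP t Ht) as D1. pose proof (HdH t ltac:(lra)) as D2.
    auto_derive.
    - split; [exists (2 * P t * (1 + kappa t) / t); exact D1|].
      split; [apply Rgt_not_eq; nra|]. split; [exists (eta t); exact D2|exact I].
    - change (Derive (fun x => P x) t) with (Derive P t).
      change (Derive (fun x => H x) t) with (Derive H t).
      rewrite (is_derive_unique _ _ _ D1), (is_derive_unique _ _ _ D2).
      field. lra. }
  assert (Hmon : forall t, 0 < t <= r -> sigma * Q r <= sigma * Q t).
  { intros t Ht. eapply monotone_of_derive_sign; [lra| |].
    - intros s Hsr. apply HQ. lra.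
    - intros s Hsr. cbv beta.
      assert (Hss : 0 < s < 1) by lra.
      pose proof (Hs s Hss). pose proof (HP s Hss).
      assert (0 <= 2 * (P s / s ^ 2 * exp (- 2 * H s)) / s).
      { apply Rdiv_le_0_compat; [|lra]. pose proof (exp_pos (- 2 * H s)).
        assert (0 <= P s / s ^ 2) by (apply Rdiv_le_0_compat; [lra|nra]). nra. }
      nra. }
  assert (HcH : filterlim H (at_right 0) (locally (H 0))).
  { apply continuous_filterlim_at_right.
    apply (ex_derive_continuous (V := R_NormedModule)). exists (eta 0). apply HdH. lra. }
  assert (HcE : filterlim (fun t => exp (- 2 * H t)) (at_right 0) (locally 1)).
  { rewrite <- exp_0. replace 0 with (- 2 * H 0) at 2 by (rewrite H0; ring).
    apply (filterlim_comp _ _ _ H (fun y => exp (- 2 * y)) _ (locally (H 0)) _ HcH).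
    apply (ex_derive_continuous (V := R_NormedModule) (fun y => exp (- 2 * y))). auto_derive. exact I. }
  assert (HlQ : filterlim (fun t => sigma * Q t) (at_right 0) (locally (sigma * 1))).
  { apply (filterlim_comp _ _ _ Q (fun y => sigma * y) _ (locally 1)).
    - replace 1 with (1 * 1) by ring.
      exact (filterlim_comp_2 _ _ Rmult Hlim HcE (filterlim_mult 1 1)).
    - apply (ex_derive_continuous (V := R_NormedModule) (fun y => sigma * y)). auto_derive. exact I. }
  assert (Hfin : sigma * Q r <= sigma * 1).
  { refine (filterlim_le (F := at_right 0) (fun _ => sigma * Q r) (fun t => sigma * Q t)
              (sigma * Q r) (sigma * 1) _ _ HlQ).
    - exists (mkposreal r (proj1 Hr)). intros t Ht Ht0. apply Hmon.
      change (Rabs (t - 0) < r) in Ht. apply Rabs_lt_between in Ht. lra.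
    - apply filterlim_const. }
  assert (E : Q r * (r * exp (H r)) ^ 2 = P r).
  { unfold Q. replace (- 2 * H r) with (- (H r + H r)) by ring.
    rewrite exp_Ropp, exp_plus. field. pose proof (exp_pos (H r)). lra. }
  rewrite <- E at 1. 
  assert (0 <= (r * exp (H r)) ^ 2) by apply pow2_ge_0. nra.
Qed.

(** * The extremal function on the real axis *)

(** The logarithm of [f_tilde beta t / t], continued to [t = 0]. *)
Definition log_factor (beta t : R) : R := (ln (1 + beta * t) - ln (1 - t)) / (1 + beta).

Lemma is_derive_log_factor beta t :
  0 <= beta < 1 -> -1 < t < 1 ->
  is_derive (log_factor beta) t (/ ((1 - t) * (1 + beta * t))).
Proof.
  intros Hb Ht. assert (0 < 1 + beta * t) by nra. unfold log_factor.
  auto_derive; [lra|]. field. lra.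
Qed.

Lemma Clog_R (x : R) : 0 < x -> Clog x = RtoC (ln x).
Proof.
  intros Hx. unfold Clog, Carg. rewrite Cmod_R, Rabs_pos_eq by lra.
  unfold RtoC, Re, Im. simpl. destruct (Rle_dec 0 0) as [_|n]; [|exfalso; lra].
  f_equal. replace (x / x) with 1 by (field; lra). apply acos_1.
Qed.

Lemma Cexp_R (x : R) : Cexp x = RtoC (exp x).
Proof.
  unfold Cexp, RtoC, Re, Im. simpl. rewrite cos_0, sin_0. f_equal; ring.
Qed.

Lemma f_tilde_R beta t :
  0 <= beta < 1 -> -1 < t < 1 -> f_tilde beta t = RtoC (t * exp (log_factor beta t)).
Proof.
  intros Hb Ht. assert (H1 : 0 < 1 + beta * t) by nra.
  unfold f_tilde, Cpower.
  rewrite <- RtoC_mult, <- !RtoC_plus, <- RtoC_minus, <- !RtoC_div by lra.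
  rewrite Clog_R by (apply Rdiv_lt_0_compat; lra).
  rewrite <- RtoC_mult, Cexp_R, <- RtoC_mult. do 3 f_equal.
  unfold log_factor. rewrite ln_div by lra. field. lra.
Qed.

(** * The growth theorem *)

(** Away from the zeros of [f] this says that [Re q / t] is the logarithmic
    derivative of [|f|]; at a zero both sides vanish, whatever the value of [q] there. *)
Lemma is_derive_sqmod_of_quotient (f q : C -> C) (e : C) (t : R) :
  analytic_on Delta f -> Cmod e = 1 -> 0 < t < 1 ->
  (f (t * e)%C <> 0%C -> q (t * e)%C = (t * e * C_derive f (t * e) / f (t * e))%C) ->
  is_derive (fun s : R => Cmod (f (s * e)%C) ^ 2) t
    (2 * Cmod (f (t * e)%C) ^ 2 * Re (q (t * e)%C) / t).
Proof.
  intros Hf He Ht Hq.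
  assert (HD : Delta (t * e)%C).
  { unfold Delta. rewrite Cmod_mult, Cmod_R, Rabs_pos_eq, He by lra. lra. }
  destruct (expansion_of_analytic _ _ _ Hf HD) as (rho & a & Hrho & Ha).
  pose proof (expansion_jet1 _ _ _ _ Hrho Ha) as Hj.
  evar_last; [exact (is_derive_sqmod_along_ray _ _ _ _ He Hj)|].
  rewrite <- (jet1_C_derive _ _ _ Hj).
  destruct (classic (f (t * e)%C = RtoC 0)) as [E|E].
  - rewrite E, Cmod_0. unfold Re. simpl. field. lra.
  - rewrite (Hq E). clear Hq. revert E.
    generalize (f (t * e)%C) as F, (C_derive f (t * e)) as F'. intros F F' E.
    assert (EQ : RtoC (Cmod F ^ 2) = (F * Cconj F)%C) by (rewrite <- Cmod2_conj, RtoC_pow; reflexivity).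
    assert (EE : (Cconj F * (e * F'))%C = (RtoC (Cmod F ^ 2) * RtoC (/ t) * (t * e * F' / F))%C).
    { rewrite EQ, RtoC_inv by lra. field. split; [exact E|].
      intros X. apply RtoC_inj in X. lra. }
    rewrite EE. generalize (t * e * F' / F)%C as qq. intros [x y].
    unfold Re, RtoC. simpl. field. lra.
Qed.

(** From [f z = z (1 + z v)] with [v] bounded by [K], the quotient lies between
    [(1 - t K)^2] and [(1 + t K)^2]. *)
Lemma normalized_limit (f : C -> C) (e : C) :
  Cmod e = 1 -> f 0%C = 0%C -> jet1 f 0%C 1%C ->
  filterlim (fun t : R => Cmod (f (t * e)%C) ^ 2 / t ^ 2) (at_right 0) (locally 1).
Proof.
  intros He Hf0 (K & d & Hd & H).
  assert (HK : 0 <= K).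
  { destruct (H 0%C) as (v & Hv & _); [rewrite Cmod_0; exact Hd|].
    pose proof (Cmod_ge_0 v). lra. }
  assert (Hb : forall t, 0 < t < d -> t * K <= 1 -> 
     (1 - t * K) ^ 2 <= Cmod (f (t * e)%C) ^ 2 / t ^ 2 <= (1 + t * K) ^ 2).
  { intros t Ht HtK. destruct (H (t * e)%C) as (v & Hv & E).
    { rewrite Cmod_mult, Cmod_R, He, Rabs_pos_eq; lra. }
    rewrite Cplus_0_l, Hf0, Cplus_0_l in E.
    rewrite E, Cmod_mult, Cmod_mult, Cmod_R, He, Rabs_pos_eq, Rmult_1_r by lra.
    replace ((t * Cmod (1 + t * e * v)) ^ 2 / t ^ 2) with (Cmod (1 + t * e * v) ^ 2) by (field; lra).
    assert (Hm : Cmod (t * e * v) <= t * K).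
    { rewrite !Cmod_mult, Cmod_R, He, Rabs_pos_eq by lra. nra. }
    split; apply pow_incr; (split; [first [apply Cmod_ge_0|lra]|]).
    - assert (1 <= Cmod (1 + t * e * v) + Cmod (t * e * v)); [|lra].
      apply Rle_trans with (Cmod ((1 + t * e * v) + - (t * e * v))%C).
      + replace (1 + t * e * v + - (t * e * v))%C with (RtoC 1) by ring. rewrite Cmod_1. lra.
      + eapply Rle_trans; [apply Cmod_triangle|]. rewrite Cmod_opp. lra.
    - eapply Rle_trans; [apply Cmod_triangle|]. rewrite Cmod_1. lra. }
  assert (Hl : forall c, filterlim (fun t => (1 + t * c) ^ 2) (at_right 0) (locally 1)).
  { intros c. 
    pose proof (continuous_filterlim_at_right (fun t => (1 + t * c) ^ 2) 0) as L. cbv beta in L.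
    replace ((1 + 0 * c) ^ 2) with 1 in L by ring. apply L.
    apply (ex_derive_continuous (V := R_NormedModule) (fun t => (1 + t * c) ^ 2)).
    auto_derive. exact I. }
  apply (filterlim_le_le (F := at_right 0) (fun t => (1 + t * - K) ^ 2) _ (fun t => (1 + t * K) ^ 2) 1).
  - assert (Hm : 0 < Rmin d (/ (K + 1))).
    { apply Rmin_pos; [exact Hd|]. apply Rinv_0_lt_compat. lra. }
    exists (mkposreal _ Hm). intros t Ht Ht0.
    change (Rabs (t - 0) < Rmin d (/ (K + 1))) in Ht. apply Rabs_lt_between in Ht.
    pose proof (Rmin_l d (/ (K + 1))). pose proof (Rmin_r d (/ (K + 1))).
    replace (1 + t * - K) with (1 - t * K) by ring. apply Hb; [lra|].
    assert (t * (K + 1) <= / (K + 1) * (K + 1)) by (apply Rmult_le_compat_r; lra).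
    rewrite Rinv_l in * by lra. lra.
  - apply Hl.
  - apply Hl.
Qed.

(** Both bounds are instances of [growth_comparison] with the same [P], the
    squared modulus of [f] along the ray through [z]: the upper one with
    [sigma = 1] and [log_factor beta t], the lower one with [sigma = - 1] and
    [log_factor beta (- t)]. *)
Theorem theorem3p9 :
  forall (beta : R) (f : C -> C),
    (0 <= beta < 1)%R -> S_cs beta f ->
    forall (z : C) (r : R), Cmod z = r -> (0 < r < 1)%R ->
      Cle (- f_tilde beta (- r))%C (Cmod (f z)) /\
      Cle (Cmod (f z)) (f_tilde beta r).
Proof.
  intros beta f Hb ((Hf & a & Ha0 & Ha1 & Ha) & q & _ & Hq & _ & _ & w & Hw & HwD & Hw0 & Hqw) z r Hz Hr.
  rewrite <- RtoC_opp, !f_tilde_R, <- RtoC_opp by lra.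
  pose (e := (z / r)%C).
  assert (Hr0 : RtoC r <> RtoC 0) by (intros X; apply RtoC_inj in X; lra).
  assert (He : Cmod e = 1).
  { unfold e. rewrite Cmod_div, Cmod_R, Rabs_pos_eq, Hz by (exact Hr0 || lra). field. lra. }
  assert (Hze : (r * e)%C = z) by (unfold e; field; exact Hr0).
  assert (Hmod : forall t : R, 0 < t < 1 -> Cmod (t * e) = t).
  { intros t Ht. rewrite Cmod_mult, Cmod_R, He, Rabs_pos_eq; lra. }
  assert (Hexp : has_expansion f 0%C 1 a).
  { intros y Hy. rewrite Cplus_0_l. apply Ha, Hy. }
  assert (Hf0 : f 0%C = 0%C) by (rewrite (expansion_center _ _ _ _ Rlt_0_1 Hexp); exact Ha0).
  pose proof (expansion_jet1 _ _ _ _ Rlt_0_1 Hexp) as Hj. rewrite Ha1 in Hj.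
  pose (P := fun t : R => Cmod (f (t * e)%C) ^ 2).
  pose (kappa := fun t : R => Re (h_cs beta (w (t * e)%C))).
  assert (HP : forall t, 0 < t < 1 -> 0 <= P t) by (intros; apply pow2_ge_0).
  assert (HdP : forall t, 0 < t < 1 -> is_derive P t (2 * P t * (1 + kappa t) / t)).
  { intros t Ht.
    assert (HD : Delta (t * e)%C) by (unfold Delta; rewrite Hmod; lra).
    replace (1 + kappa t) with (Re (q (t * e)%C)).
    - apply is_derive_sqmod_of_quotient; try assumption. apply Hq, HD.
    - unfold kappa. rewrite <- (Hqw _ HD). unfold Re. simpl. ring. }
  assert (Hlim := normalized_limit f e He Hf0 Hj).
  assert (Hk : forall t, 0 < t < 1 ->
     - t / ((1 + t) * (1 - beta * t)) <= kappa t <= t / ((1 - t) * (1 + beta * t))).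
  { intros t Ht. apply Re_h_cs_bounds; [exact Hb| |lra].
    rewrite <- (Hmod t Ht) at 2. apply schwarz_lemma; try assumption.
    unfold Delta. rewrite Hmod; lra. }
  assert (H0 : log_factor beta 0 = 0).
  { unfold log_factor. rewrite Rmult_0_r, Rplus_0_r, Rminus_0_r. rewrite ln_1. field. lra. }
  assert (Hup : 1 * P r <= 1 * (r * exp (log_factor beta r)) ^ 2).
  { apply (growth_comparison 1 P (log_factor beta) kappa
             (fun t => / ((1 - t) * (1 + beta * t)))); try assumption.
    - intros t Ht. apply is_derive_log_factor; lra.
    - intros t Ht. pose proof (Hk t Ht). unfold Rdiv in *. lra. }
  assert (Hlo : -1 * P r <= -1 * (r * exp (log_factor beta (- r))) ^ 2).
  { apply (growth_comparison (-1) P (fun t => log_factor beta (- t)) kappa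
             (fun t => - / ((1 + t) * (1 - beta * t)))); try assumption.
    - intros t Ht. evar_last.
      + apply (is_derive_comp (V := R_NormedModule) (log_factor beta) Ropp).
        * apply is_derive_log_factor; lra.
        * apply (is_derive_opp (V := R_NormedModule) (fun x : R => x)). apply is_derive_id.
      + unfold scal, opp, one. simpl. unfold mult. simpl.
        replace (1 - - t) with (1 + t) by ring. replace (1 + beta * - t) with (1 - beta * t) by ring.
        ring.
    - rewrite Ropp_0. exact H0.
    - intros t Ht. pose proof (Hk t Ht). unfold Rdiv in *. lra. }
  unfold P in Hup, Hlo. rewrite Hze in Hup, Hlo.
  pose proof (Cmod_ge_0 (f z)).
  pose proof (exp_pos (log_factor beta r)). pose proof (exp_pos (log_factor beta (- r))).
  unfold Cle, Re, Im. simpl. split; (split; [reflexivity|]).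
  - apply Rsqr_incr_0_var; [|assumption]. unfold Rsqr. nra.
  - apply Rsqr_incr_0_var; [unfold Rsqr; nra|]. apply Rmult_le_pos; lra.
Qed.
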